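(* Let $n\ge1$, $\delta>0$, $\beta<n+2$, $\mu,\lambda^*\in\mathbb{R}$, and $\nu\in\mathbb{R}^n\setminus\{0\}$. The eigenvalue of $M^{\delta,\beta}(\nu)$ associated with the direction of $\nu$ is $$\lambda_1(\nu)=(n+2)\mu\,c^{\delta,\beta}\int_{B_\delta(0)}\frac{(\nu\cdot w)^2}{\|\nu\|^2\|w\|^{\beta+2}}\big(\cos(\nu\cdot w)-1\big)\,dw-(\lambda^*-\mu)\left(\frac{c^{\delta,\beta}}{2}\int_{B_\delta(0)}\frac{\nu\cdot w}{\|\nu\|\,\|w\|^{\beta}}\sin(\nu\cdot w)\,dw\right)^2,$$ and the eigenvalue of $M^{\delta,\beta}(\nu)$ associated with directions orthogonal to $\nu$ is $$\lambda_2(\nu)=(n+2)\mu\,c^{\delta,\beta}\int_{B_\delta(0)}\frac{\nu\cdot w}{\|\nu\|^2\|w\|^{\beta+2}}\big(\sin(\nu\cdot w)-\nu\cdot w\big)\,dw.$$ That is, with these values, $M^{\delta,\beta}(\nu)\nu=\lambda_1(\nu)\nu$, and $M^{\delta,\beta}(\nu)\eta=\lambda_2(\nu)\eta$ for every $\eta\in\mathbb{R}^n$ with $\eta\cdot\nu=0$.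
   Context: $B_\delta(0)$ is the ball of radius $\delta$ centered at $0$ in $\mathbb{R}^n$; $v\otimes w$ is the matrix with entries $v_iw_j$. With $$c^{\delta,\beta}=\left(\frac{1}{2n}\int_{B_\delta(0)}\frac{\|w\|^2}{\|w\|^\beta}\,dw\right)^{-1}=\frac{2(n+2-\beta)\Gamma\left(\frac n2+1\right)}{\pi^{n/2}\delta^{n+2-\beta}},$$ the multiplier of the linear peridynamic operator is the $n\times n$ matrix $M^{\delta,\beta}(\nu)=M_b(\nu)+M_s(\nu)$, where $$M_b(\nu)=(n+2)\,\mu\,c^{\delta,\beta}\int_{B_\delta(0)}\frac{w\otimes w}{\|w\|^{\beta+2}}\big(\cos(\nu\cdot w)-1\big)\,dw,$$ $$M_s(\nu)=-(\lambda^*-\mu)\frac{(c^{\delta,\beta})^2}{4}\left(\int_{B_\delta(0)}\frac{w}{\|w\|^\beta}\sin(\nu\cdot w)\,dw\right)\otimes\left(\int_{B_\delta(0)}\frac{w}{\|w\|^\beta}\sin(\nu\cdot w)\,dw\right).$$ *)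

(* Defs.v *)
From HB Require Import structures.
From mathcomp Require Import all_boot all_order all_algebra.
From mathcomp Require Import all_classical all_reals all_analysis.

Set Implicit Arguments.
Unset Strict Implicit.
Unset Printing Implicit Defensive.

Import Order.TTheory GRing.Theory Num.Theory.
Import numFieldNormedType.Exports.

Local Open Scope classical_set_scope.
Local Open Scope ring_scope.

(* Lebesgue measure on R^n, carried by [n.-tuple R] with the Borel (product)
   sigma-algebra: the (n+1)-dimensional measure is the image of the product of
   the 1-dimensional and the n-dimensional one under (x, t) |-> x :: t. *)
Section lebesgue_measure_tuple.
Context {R : realType}.
Local Notation RT := (measurableTypeR R).

Definition cons_pair n (p : RT * n.-tuple RT) : n.+1.-tuple RT :=
  [tuple of p.1 :: p.2].

Lemma measurable_cons_pair n : measurable_fun [set: RT * n.-tuple RT]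
  (@cons_pair n).
Proof. by apply: measurable_cons. Qed.

HB.instance Definition _ n := isMeasurableFun.Build _ _ _ _ (@cons_pair n)
  (@measurable_cons_pair n).

Section step.
Variables (n : nat) (mu : {sigma_finite_measure set (n.-tuple RT) -> \bar R}).

Definition lebesgue_step : set (n.+1.-tuple RT) -> \bar R :=
  pushforward (lebesgue_measure \x mu)%E (@cons_pair n).

Let lebesgue_step0 : lebesgue_step set0 = 0%E.
Proof. exact: measure0. Qed.

Let lebesgue_step_ge0 A : (0 <= lebesgue_step A)%E.
Proof. exact: measure_ge0. Qed.

Let lebesgue_step_sigma_additive : semi_sigma_additive lebesgue_step.
Proof. exact: measure_semi_sigma_additive. Qed.

HB.instance Definition _ := isMeasure.Build _ _ _ lebesgue_step
  lebesgue_step0 lebesgue_step_ge0 lebesgue_step_sigma_additive.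

Let uncons (t : n.+1.-tuple RT) : RT * n.-tuple RT :=
  (thead t, [tuple of behead t]).

Let consK : cancel (@cons_pair n) uncons.
Proof. by case=> x t; congr (_, _); apply/val_inj. Qed.

Let unconsK : cancel uncons (@cons_pair n).
Proof. by move=> t; rewrite [RHS]tuple_eta; apply/val_inj. Qed.

Let measurable_uncons : measurable_fun setT uncons.
Proof.
apply/measurable_fun_pairP; split; first exact: measurable_tnth.
exact: measurable_behead.
Qed.

Let sigma_finite_lebesgue_step : sigma_finite setT lebesgue_step.
Proof.
have /sigma_finiteP[F [TF ndF Foo]] := sigma_finiteT (@lebesgue_measure R).
have /sigma_finiteP[G [TG ndG Goo]] := sigma_finiteT mu.
exists (fun k => uncons @^-1` (F k `*` G k)).
  apply/esym; rewrite -subTset => t _ /=.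
  have [[k _ Fk] [l _ Gl]] : (\bigcup_k F k) (uncons t).1 /\
      (\bigcup_k G k) (uncons t).2 by rewrite -TF -TG.
  exists (maxn k l) => //; split.
    by move: Fk; exact/subsetPset/ndF/leq_maxl.
  by move: Gl; exact/subsetPset/ndG/leq_maxr.
move=> k; have [mF Fk] := Foo k; have [mG Gk] := Goo k; split.
  by rewrite -[X in measurable X]setTI; apply: measurable_uncons => //;
    exact: measurableX.
rewrite /lebesgue_step /pushforward -comp_preimage.
rewrite (_ : uncons \o _ = id) ?preimage_id; last first.
  by apply/funext => p; exact: consK.
by rewrite product_measure1E// lte_mul_pinfty// ge0_fin_numE.
Qed.

HB.instance Definition _ := Measure_isSigmaFinite.Build _ _ _ lebesgue_step
  sigma_finite_lebesgue_step.

End step.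

Fixpoint lebesgue_measure_tuple n :
    {sigma_finite_measure set (n.-tuple RT) -> \bar R} :=
  match n return {sigma_finite_measure set (n.-tuple RT) -> \bar R} with
  | 0%N => \d_([tuple] : 0.-tuple RT)
  | n.+1 => lebesgue_step (lebesgue_measure_tuple n)
  end.

Lemma lebesgue_measure_tuple_box n (A : 'I_n -> set RT) :
  (forall i, measurable (A i)) ->
  lebesgue_measure_tuple n [set t | forall i, A i (tnth t i)] =
  (\prod_(i < n) lebesgue_measure (A i))%E.
Proof.
elim: n A => [|n IH] A mA.
  by rewrite big_ord0 /= diracE mem_set// => -[].
rewrite big_ord_recl /= -IH//.
pose B := [set t : n.-tuple RT | forall i, A (lift ord0 i) (tnth t i)].
have mB : measurable B.
  rewrite (_ : B = \bigcap_(i in [set: 'I_n])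
    ((fun t : n.-tuple RT => tnth t i) @^-1` A (lift ord0 i))).
    apply: fin_bigcap_measurable => // i _.
    by rewrite -[X in measurable X]setTI; exact: measurable_tnth.
  by apply/seteqP; split=> [t Bt i _|t Bt i]; [exact: Bt|exact: (Bt i I)].
rewrite -/B -product_measure1E// /lebesgue_step /pushforward; congr (_ _).
apply/seteqP; split=> [[x t] /= Axt|[x t] [/= Ax Bt] i].
  split => [|i]; first by have := Axt ord0.
  by have := Axt (lift ord0 i); rewrite /cons_pair tnthS.
by case: (unliftP ord0 i) => [j ->|->]; rewrite /cons_pair ?tnthS//; exact: Bt.
Qed.

End lebesgue_measure_tuple.

Section peridynamic_multiplier.
Context {R : realType} {n : nat}.
Implicit Types (v w nu : 'cV[R]_n) (delta beta mu lambda : R).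

Definition dotv v w : R := \sum_(i < n) v i 0 * w i 0.

(* the library's norm `|v| on matrices is the sup norm *)
Definition enorm v : R := Num.sqrt (dotv v v).

Definition tensor v w : 'M[R]_n := \matrix_(i, j) (v i 0 * w j 0).

Definition vec (t : n.-tuple (measurableTypeR R)) : 'cV[R]_n :=
  \col_i tnth t i.

Definition ball_integral delta (f : 'cV[R]_n -> R) : R :=
  \int[lebesgue_measure_tuple n]_(t in [set t | enorm (vec t) < delta])
    f (vec t).

Definition ball_integral_mx p q delta (F : 'cV[R]_n -> 'M[R]_(p, q)) :
    'M[R]_(p, q) :=
  \matrix_(i, j) ball_integral delta (fun w => F w i j).

(* [`^] is the real power; at w = 0 the integrands below take
   conventional values (the inverse of 0 is 0), on a null set when n > 0. *)
Definition c_coef delta beta : R :=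
  ((2 * n%:R)^-1 *
   ball_integral delta (fun w => enorm w ^+ 2 / enorm w `^ beta))^-1.

Definition M_b delta beta mu nu : 'M[R]_n :=
  ((n%:R + 2) * mu * c_coef delta beta) *:
  ball_integral_mx delta (fun w =>
    (cos (dotv nu w) - 1) *: ((enorm w `^ (beta + 2))^-1 *: tensor w w)).

Definition M_s delta beta mu lambda nu : 'M[R]_n :=
  let S := ball_integral_mx delta (fun w =>
    sin (dotv nu w) *: ((enorm w `^ beta)^-1 *: w)) in
  (- (lambda - mu) * (c_coef delta beta ^+ 2 / 4)) *: tensor S S.

Definition multiplier delta beta mu lambda nu : 'M[R]_n :=
  M_b delta beta mu nu + M_s delta beta mu lambda nu.

Definition lambda1 delta beta mu lambda nu : R :=
  (n%:R + 2) * mu * c_coef delta beta *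
    ball_integral delta (fun w =>
      dotv nu w ^+ 2 / (enorm nu ^+ 2 * enorm w `^ (beta + 2)) *
      (cos (dotv nu w) - 1))
  - (lambda - mu) *
    (c_coef delta beta / 2 *
     ball_integral delta (fun w =>
       dotv nu w / (enorm nu * enorm w `^ beta) * sin (dotv nu w))) ^+ 2.

Definition lambda2 delta beta mu nu : R :=
  (n%:R + 2) * mu * c_coef delta beta *
    ball_integral delta (fun w =>
      dotv nu w / (enorm nu ^+ 2 * enorm w `^ (beta + 2)) *
      (sin (dotv nu w) - dotv nu w)).

End peridynamic_multiplier.

(* Main.v *)
Require Import Defs.
From HB Require Import structures.
From mathcomp Require Import all_boot all_order all_algebra.
From mathcomp Require Import all_classical all_reals all_analysis.
From mathcomp Require Import measurable_realfun ring lra.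

Import Order.TTheory GRing.Theory Num.Theory.
Import numFieldNormedType.Exports.

Local Open Scope classical_set_scope.
Local Open Scope ring_scope.

(** All integrands are O(|w|^(2 - beta)), which is integrable on the ball since
    beta < n + 2, so everything reduces to symmetries of Lebesgue measure.
    Testing M nu against zeta orthogonal to nu, or M eta against zeta
    orthogonal to eta, gives an integrand that is odd under a reflection
    (w |-> w - 2 (zeta.w / zeta.zeta) zeta, resp. the one along eta), hence the
    eigenvector equations.  The value of lambda2 comes from the rotations Q_x
    in the plane (nu, eta), with |eta| = |nu|: the integral of
    F w = (eta.w) |w|^(-beta-2) (sin (nu.w) - nu.w) over the ball is unchanged
    if F is replaced by F o Q_x, and differentiating at x = 0 yields
      int (eta.w)^2 |w|^(-beta-2) (cos (nu.w) - 1)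
        = int (nu.w) |w|^(-beta-2) (sin (nu.w) - nu.w). *)

(** * Lebesgue measure on tuples *)

(** The measure structure on a pushforward depends on the proof of measurability. Packaging it as an
    existential gives a genuine measure to which uniqueness theorems apply. *)
Lemma ex_pushforward d1 d2 (X : measurableType d1) (Y : measurableType d2)
    (R : realType) (m : {measure set X -> \bar R}) (f : X -> Y) :
  measurable_fun setT f ->
  exists m' : {measure set Y -> \bar R}, forall A, m' A = m (f @^-1` A).
Proof.
move=> mf.
by exists (measure_function_pushforward__canonical__measure_function_Measure m mf).
Qed.

Section lebesgue_tuple.
Context {R : realType} {n : nat}.
Local Notation RT := (measurableTypeR R).
Local Notation T := (n.-tuple RT).
Local Notation leb := (@lebesgue_measure_tuple R n).

(** The pushforward under the shift gives each half-open interval its length, so uniqueness of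
    Lebesgue measure applies. *)
Lemma lebesgue_measure_shift (a : R) (A : set RT) : measurable A ->
  lebesgue_measure [set x : RT | A (x + a)] = lebesgue_measure A.
Proof.
move=> mA; pose shift (x : RT) : RT := x + a.
have mshift : measurable_fun setT shift by exact: measurable_funD.
have [m mE] := ex_pushforward _ _ _ _ _ (@lebesgue_measure R) _ mshift.
rewrite -[LHS]/(lebesgue_measure (shift @^-1` A)) -mE; apply/esym.
apply: (@lebesgue_measure_unique R m) => // X [[x y] _ <-] /=.
rewrite mE.
rewrite lebesgue_measure_itv /=.
rewrite (_ : _ @^-1` _ = `]x - a, y - a]%classic); last first.
  by apply/seteqP; split=> z /=; rewrite /shift !in_itv /= ltrBlDr lerBrDr.
rewrite lebesgue_measure_itv /= !lte_fin ltrD2r.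
by case: ifP => // _; rewrite -!EFinB; congr _%:E; ring.
Qed.

Definition unvec (v : 'cV[R]_n) : T := [tuple v i 0 | i < n].

Lemma unvecK : cancel unvec (@vec R n).
Proof. by move=> v; apply/colP => i; rewrite mxE tnth_mktuple. Qed.

Lemma vecK : cancel (@vec R n) unvec.
Proof. by move=> t; apply: eq_from_tnth => i; rewrite tnth_mktuple mxE. Qed.

Definition box (B : 'I_n -> set RT) : set T := [set t | forall i, B i (tnth t i)].

Lemma measurable_box B : (forall i, measurable (B i)) -> measurable (box B).
Proof.
move=> mB.
rewrite (_ : box B = \bigcap_(i in [set: 'I_n])
    ((fun t : T => tnth t i) @^-1` B i)).
  apply: fin_bigcap_measurable => // i _.
  by rewrite -[X in measurable X]setTI; exact: measurable_tnth.
by apply/seteqP; split=> [t Bt i _|t Bt i]; [exact: Bt|exact: (Bt i I)].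
Qed.

Definition boxes : set (set T) :=
  [set box B | B in [set B : 'I_n -> set RT | forall i, measurable (B i)]].

Lemma measurable_tuple_boxes : measurable = <<s boxes >> :> set (set T).
Proof.
apply/seteqP; split; apply: smallest_sub.
- exact: smallest_sigma_algebra.
- move=> A; rewrite -bigcup_seq => -[i _ [B mB <-]].
  apply: sub_sigma_algebra.
  exists (fun j => if j == i then B else setT).
    by move=> j; case: ifP.
  apply/seteqP; split=> t /=.
    by move=> /(_ i); rewrite eqxx.
  by move=> [_ Bt] j; case: eqP => [->|].
- exact: sigma_algebra_measurable.
- by move=> _ [B mB <-]; exact: measurable_box.
Qed.

(** The boxes generate the sigma-algebra and are stable under intersection, and the cubes with sides
    [-k, k] exhaust the space with finite measure, so a measure is determined by its values on
    boxes. *)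
Lemma lebesgue_tuple_unique (m : {measure set T -> \bar R}) :
  (forall B, (forall i, measurable (B i)) -> m (box B) = leb (box B)) ->
  forall A, measurable A -> m A = leb A.
Proof.
move=> mE A mA; apply/esym.
pose itvk (k : nat) (i : 'I_n) : set RT := `[- k%:R, k%:R]%classic.
have mitvk k i : measurable (itvk k i) by exact: measurable_itv.
apply: (measure_unique boxes (fun k => box (itvk k))) => //.
- exact: measurable_tuple_boxes.
- move=> _ _ [B mB <-] [C mC <-].
  exists (fun i => B i `&` C i); first by move=> i; exact: measurableI.
  apply/seteqP; split=> [t h|t [Bt Ct] i]; last by split; [exact: Bt|exact: Ct].
  by split=> i; have [] := h i.
- by move=> k; exists (itvk k).
- rewrite -subTset => t _.
  (* A cube containing t: k dominates the absolute values of all coordinates. *)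
  exists (\max_(i < n) Num.bound `|tnth t i : R|) => // i.
  rewrite /itvk /= in_itv /= -ler_norml.
  apply: (le_trans (ltW (archi_boundP (normr_ge0 (tnth t i : R))))).
  by rewrite ler_nat; apply: (@leq_bigmax _ (fun i => Num.bound `|tnth t i : R|)).
- by move=> _ [B mB <-]; rewrite mE.
- move=> k; suff : (leb (box (itvk k)) < +oo)%E by [].
  rewrite /box lebesgue_measure_tuple_box// ltey_eq; apply/orP; left.
  apply: (big_ind (fun x => x \is a fin_num)) => // [x y fx fy|i _].
    exact: fin_numM.
  by rewrite /itvk lebesgue_measure_itv /=; case: ifP.
Qed.

Lemma measurable_vec_coord i : measurable_fun setT (fun t : T => vec t i 0).
Proof.
rewrite (_ : (fun t => _) = (fun t : T => tnth t i)).
  exact: measurable_tnth.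
by apply/funext => t; rewrite mxE.
Qed.

Lemma measurable_unvec d (X : measurableType d) (f : X -> 'cV[R]_n) :
  (forall i, measurable_fun setT (fun x => f x i 0)) ->
  measurable_fun setT (unvec \o f).
Proof.
move=> mf; apply/measurable_fun_tnthP => i.
by apply: eq_measurable_fun (mf i) => x _; rewrite /= tnth_mktuple.
Qed.

Lemma measurable_shift (v : 'cV[R]_n) :
  measurable_fun setT (fun t : T => unvec (vec t + v)).
Proof.
apply: (measurable_unvec _ _ (fun t : T => vec t + v)) => i.
apply: (@eq_measurable_fun _ _ _ _ _ (fun t : T => vec t i 0 + v i 0)).
  by move=> t _; rewrite [in RHS]mxE.
by apply: measurable_funD => //; exact: measurable_vec_coord.
Qed.

(** A translate of a box is a box, so on boxes the claim reduces to the one-dimensional shift in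
    each coordinate. *)
Lemma lebesgue_tuple_shift (v : 'cV[R]_n) (A : set T) : measurable A ->
  leb [set t | A (unvec (vec t + v))] = leb A.
Proof.
move=> mA; pose shift (t : T) := unvec (vec t + v).
have mshift : measurable_fun setT shift by exact: measurable_shift.
have [m mE] := ex_pushforward _ _ _ _ _ leb _ mshift.
rewrite -[LHS]/(leb (shift @^-1` A)) -mE.
apply: lebesgue_tuple_unique => // B mB.
pose B' i := [set x : RT | B i (x + v i 0 : R)].
have mB' i : measurable (B' i).
  have mi : measurable_fun setT (fun x : RT => x + v i 0 : RT).
    exact: measurable_funD.
  by rewrite -[X in measurable X]setTI; exact: mi.
rewrite mE (_ : _ @^-1` _ = box B').
  rewrite [LHS]lebesgue_measure_tuple_box// [RHS]lebesgue_measure_tuple_box//.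
  by apply: eq_bigr => i _; exact: lebesgue_measure_shift.
by apply/seteqP; split=> t h i; have := h i; rewrite /shift tnth_mktuple !mxE.
Qed.

Lemma measurable_unvec_mulmx (Q : 'M[R]_n) :
  measurable_fun setT (fun t : T => unvec (Q *m vec t)).
Proof.
apply: (measurable_unvec _ _ (fun t : T => Q *m vec t)) => i.
apply: (@eq_measurable_fun _ _ _ _ _
  (fun t : T => \sum_(j < n) Q i j * vec t j 0)).
  by move=> t _; rewrite mxE.
apply: measurable_sum => j; apply: measurable_funM => //.
exact: measurable_vec_coord.
Qed.

Let affine_set (A B : set T) (Q : 'M[R]_n) : set (T * T) :=
  [set p | A p.1 /\ B (unvec (vec p.1 + Q *m vec p.2))].

Let measurable_affine_set A B Q : measurable A -> measurable B ->
  measurable (affine_set A B Q).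
Proof.
move=> mA mB; apply: measurableI.
  by rewrite -[X in measurable X]setTI; exact: measurable_fst.
pose h (p : T * T) := unvec (vec p.1 + Q *m vec p.2).
suff mh : measurable_fun setT h by rewrite -[X in measurable X]setTI; exact: mh.
apply: (measurable_unvec _ _ (fun p : T * T => vec p.1 + Q *m vec p.2)) => i.
apply: (@eq_measurable_fun _ _ _ _ _ (fun p : T * T =>
  vec p.1 i 0 + vec (unvec (Q *m vec p.2)) i 0)).
  by move=> p _; rewrite unvecK [in RHS]mxE.
apply: measurable_funD.
  by apply: (measurableT_comp (measurable_vec_coord i)); exact: measurable_fst.
apply: (measurableT_comp (measurable_vec_coord i)).
by apply: (measurableT_comp (measurable_unvec_mulmx Q)); exact: measurable_snd.
Qed.

Let measurable_EFin_indic d (X : measurableType d) (S : set X) : measurable S ->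
  measurable_fun setT (fun x => (\1_S x)%:E : \bar R).
Proof. by move=> mS; apply/measurable_EFinP; exact: measurable_indic. Qed.

(** For x in A, the slice of those y with x + Q y in B is the translate by - Q^-1 x of those y with
    Q y in B. Its measure therefore does not depend on x, and integrating over A gives the
    product. *)
Let integral_affine_set A B Q :
  Q \in unitmx -> measurable A -> measurable B ->
  (\int[leb]_x \int[leb]_y (\1_(affine_set A B Q) (x, y))%:E =
   leb A * leb [set t | B (unvec (Q *m vec t))])%E.
Proof.
move=> uQ mA mB; set C := [set t | _].
have mC : measurable C.
  by rewrite -[X in measurable X]setTI; exact: measurable_unvec_mulmx.
rewrite muleC -integral_cst// integral_mkcond.
apply: eq_integral => x _; rewrite patchE.
case: ifPn => [/set_mem Ax|/negP Ax]; last first.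
  apply: integral0_eq => y _; rewrite indicE memNset//.
  by move=> [Ax' _]; apply: Ax; apply/mem_set.
rewrite -(lebesgue_tuple_shift (invmx Q *m vec x))// -[in RHS](setIT [set t | _]).
rewrite -integral_indic//; last first.
  by rewrite -[X in measurable X]setTI; exact: measurable_shift.
apply: eq_integral => y _; congr _%:E.
rewrite !indicE; congr (nat_of_bool _)%:R.
apply/idP/idP => /set_mem /= h; apply/mem_set => /=.
  by rewrite /C /= unvecK mulmxDr mulKVmx// addrC; case: h.
by split => //; move: h; rewrite /C /= unvecK mulmxDr mulKVmx// addrC.
Qed.

(* Weil's argument for the uniqueness of Haar measure: both sides are the
   measure of {(x, y) | x \in A, x + Q y \in B}, sliced along x and along y. *)
Lemma lebesgue_tuple_mulmx (Q : 'M[R]_n) (A B : set T) :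
  Q \in unitmx -> measurable A -> measurable B ->
  (leb A * leb [set t | B (unvec (Q *m vec t))] =
   leb B * leb [set t | A (unvec (- Q *m vec t))])%E.
Proof.
move=> uQ mA mB.
have uQN : - Q \in unitmx by rewrite -scaleN1r unitmxZ// unitrN unitr1.
have swap A' B' Q' : measurable A' -> measurable B' ->
    (\int[leb]_x \int[leb]_y (\1_(affine_set A' B' Q') (x, y))%:E =
     \int[leb]_y \int[leb]_x (\1_(affine_set A' B' Q') (x, y))%:E)%E.
  move=> mA' mB'.
  apply: (@fubini_tonelli _ _ _ _ _ leb leb
    (fun p => (\1_(affine_set A' B' Q') p)%:E)) => //.
  by apply: measurable_EFin_indic; exact: measurable_affine_set.
apply: etrans (esym (integral_affine_set _ _ _ uQ mA mB)) _.
apply: etrans (integral_affine_set _ _ _ uQN mB mA).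
apply: etrans (swap A B Q mA mB) _.
apply: etrans _ (esym (swap B A (- Q) mB mA)).
apply: eq_integral => y _.
have slice A' B' Q' : measurable A' -> measurable B' ->
    (\int[leb]_x (\1_(affine_set A' B' Q') (x, y))%:E =
    leb [set x | A' x /\ B' (unvec (vec x + Q' *m vec y))])%E.
  move=> mA' mB'; rewrite -[X in leb X]setIT -integral_indic//.
  apply: measurableI => //.
  by rewrite -[X in measurable X]setTI; exact: measurable_shift.
(* Translating x by Q y turns the conditions x in B, x - Q y in A into x + Q y in B, x in A. *)
rewrite !slice// -[RHS](lebesgue_tuple_shift (Q *m vec y)); last first.
  apply: measurableI => //.
  by rewrite -[X in measurable X]setTI; exact: measurable_shift.
by congr (leb _); apply/seteqP; split=> x /=;
  rewrite unvecK mulNmx addrK vecK => -[].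
Qed.

End lebesgue_tuple.

(** * Invariance under isometries *)

Section dot_product.
Context {R : realType} {n : nat}.
Implicit Types (u v w : 'cV[R]_n).

Lemma dotvC v w : dotv v w = dotv w v.
Proof. by apply: eq_bigr => i _; rewrite mulrC. Qed.

Lemma dotvDr u v w : dotv u (v + w) = dotv u v + dotv u w.
Proof. by rewrite -big_split; apply: eq_bigr => i _; rewrite mxE mulrDr. Qed.

Lemma dotvZr u (a : R) v : dotv u (a *: v) = a * dotv u v.
Proof. by rewrite mulr_sumr; apply: eq_bigr => i _; rewrite mxE mulrCA. Qed.

Lemma dotvDl u v w : dotv (v + w) u = dotv v u + dotv w u.
Proof. by rewrite !(dotvC _ u) dotvDr. Qed.

Lemma dotvZl u (a : R) v : dotv (a *: v) u = a * dotv v u.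
Proof. by rewrite !(dotvC _ u) dotvZr. Qed.

Lemma dotv0 u : dotv u 0 = 0.
Proof. by rewrite -(scale0r 0) dotvZr mul0r. Qed.

Lemma dotv_ge0 v : 0 <= dotv v v.
Proof. by apply: sumr_ge0 => i _; rewrite -expr2 sqr_ge0. Qed.

Lemma dotv_eq0 v : (dotv v v == 0) = (v == 0).
Proof.
apply/eqP/eqP => [v0|->]; last exact: dotv0.
apply/colP => i; rewrite mxE; apply/eqP; rewrite -sqrf_eq0 expr2; apply/eqP.
by apply: (psumr_eq0P _ v0) => // j _; rewrite -expr2 sqr_ge0.
Qed.

Lemma enorm_ge0 v : 0 <= enorm v.
Proof. exact: sqrtr_ge0. Qed.

Lemma sqr_enorm v : enorm v ^+ 2 = dotv v v.
Proof. by rewrite sqr_sqrtr// dotv_ge0. Qed.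

Lemma enorm_eq0 v : (enorm v == 0) = (v == 0).
Proof. by rewrite -dotv_eq0 -sqr_enorm sqrf_eq0. Qed.

Lemma coord_le_enorm v i : `|v i 0| <= enorm v.
Proof.
rewrite -(ler_pXn2r (n:=2))// ?nnegrE ?enorm_ge0// sqr_enorm real_normK ?num_real//.
rewrite /dotv (bigD1 i)//= -expr2 lerDl sumr_ge0// => j _.
by rewrite -expr2 sqr_ge0.
Qed.

Lemma sqr_enorm_le v (r : R) : (forall i, `|v i 0| <= r) ->
  enorm v ^+ 2 <= n%:R * r ^+ 2.
Proof.
move=> vr; rewrite sqr_enorm /dotv mulr_natl.
rewrite -[X in _ *+ X](card_ord n) -sumr_const; apply: ler_sum => i _.
rewrite -expr2 -real_normK ?num_real// lerXn2r ?nnegrE//.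
exact: le_trans (vr i).
Qed.

Lemma dotv_le v w : `|dotv v w| <= enorm v * enorm w.
Proof.
have [->|w0] := eqVneq w 0.
  by rewrite dotv0 normr0 mulr_ge0 ?enorm_ge0.
rewrite -(ler_pXn2r (n:=2))// ?nnegrE ?mulr_ge0 ?enorm_ge0//.
rewrite real_normK ?num_real// exprMn !sqr_enorm.
have ww : 0 < dotv w w by rewrite lt_neqAle dotv_ge0 eq_sym dotv_eq0 w0.
(* The coefficient of the orthogonal projection of v onto w; the inequality is the nonnegativity of
   the squared norm of v - c w. *)
set c := dotv v w / dotv w w.
have := dotv_ge0 (v + (- c) *: w).
rewrite !dotvDr !dotvDl !dotvZr !dotvZl (dotvC w v).
rewrite (_ : _ + _ = dotv v v - dotv v w ^+ 2 / dotv w w); last first.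
  by rewrite /c; field; rewrite gt_eqF.
by rewrite subr_ge0 ler_pdivrMr.
Qed.

Lemma dotv_delta w k :
  dotv (delta_mx k 0) w = w k 0.
Proof.
rewrite /dotv (bigD1 k)//= mxE !eqxx mul1r big1 ?addr0// => l lk.
by rewrite mxE (negPf lk) mul0r.
Qed.

End dot_product.

Section isometry.
Context {R : realType} {n : nat}.
Local Notation RT := (measurableTypeR R).
Local Notation T := (n.-tuple RT).
Local Notation leb := (@lebesgue_measure_tuple R n).

Definition isometric_mx (Q : 'M[R]_n) := forall w, dotv (Q *m w) (Q *m w) = dotv w w.

Lemma enorm_isometry Q w : isometric_mx Q -> enorm (Q *m w) = enorm w.
Proof. by rewrite /enorm => ->. Qed.

Lemma isometryN Q : isometric_mx Q -> isometric_mx (- Q).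
Proof.
by move=> iQ w; rewrite mulNmx -scaleN1r dotvZr dotvZl iQ !mulN1r opprK.
Qed.

(** A kernel vector has the norm of its image, which is zero. The determinant is transposed because
    [det0P] produces a row vector. *)
Lemma isometry_unitmx Q : isometric_mx Q -> Q \in unitmx.
Proof.
move=> iQ; rewrite unitmxE unitfE -det_tr; apply/negP => /det0P[v v0 vQ].
move/eqP: v0; apply; apply: trmx_inj; rewrite trmx0; apply/eqP.
rewrite -dotv_eq0 -iQ.
by rewrite -[Q]trmxK -trmx_mul vQ trmx0 dotv0.
Qed.

Definition eball (r : R) : set T := [set t | enorm (vec t) < r].

Lemma measurable_dotv (v : 'cV[R]_n) :
  measurable_fun setT (fun t : T => dotv v (vec t)).
Proof.
apply: measurable_sum => i; apply: measurable_funM => //.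
exact: measurable_vec_coord.
Qed.

Lemma measurable_enorm : measurable_fun setT (fun t : T => enorm (vec t)).
Proof.
apply: (measurableT_comp (f:=@Num.sqrt R)).
  by apply: continuous_measurable_fun => x; exact: sqrt_continuous.
by apply: measurable_sum => i; apply: measurable_funM; exact: measurable_vec_coord.
Qed.

Lemma measurable_eball r : measurable (eball r).
Proof.
rewrite (_ : eball r = (fun t : T => enorm (vec t)) @^-1` [set x | x < r]).
  rewrite -[X in measurable X]setTI; apply: measurable_enorm => //.
  by rewrite -set_itvNyo; exact: measurable_itv.
by [].
Qed.

Lemma lebesgue_tuple_cube (r : R) : 0 <= r ->
  leb (box (fun=> `[- r, r]%classic)) = ((2 * r) ^+ n)%:E.
Proof.
move=> r0; rewrite [LHS]lebesgue_measure_tuple_box//.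
have -> : lebesgue_measure (`[- r, r]%classic : set RT) = (2 * r)%:E.
  rewrite lebesgue_measure_itv /= lte_fin.
  case: ltP => [_|r0']; first by rewrite -EFinB opprK; congr _%:E; ring.
  by rewrite (_ : r = 0) ?mulr0//; lra.
by rewrite prodEFin prodr_const card_ord.
Qed.

Lemma eball_sub_cube r :
  eball r `<=` box (fun=> `[- r, r]%classic).
Proof.
move=> t /ltW tr i /=; rewrite in_itv /= -ler_norml.
by have := coord_le_enorm (vec t) i; rewrite mxE => /le_trans; apply.
Qed.

Lemma cube_sub_eball : box (fun=> `[- 1, 1]%classic) `<=` eball (n%:R + 1).
Proof.
move=> t t1; rewrite /eball /=.
have n0 : 0 <= n%:R :> R by [].
rewrite -(ltr_pXn2r (n:=2))// ?nnegrE ?enorm_ge0 ?addr_ge0//.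
(* On the unit cube the squared norm is at most n, and n < (n + 1)^2, also when n = 0. *)
apply: (le_lt_trans (sqr_enorm_le (vec t) 1 _)); last by nra.
by move=> i; have := t1 i; rewrite mxE /= in_itv /= -ler_norml.
Qed.

(** Apply [lebesgue_tuple_mulmx] to - Q with B a ball. Isometries preserve B, so leb B appears as a
    factor on both sides, and it cancels because it is positive and finite, by comparison with
    cubes. *)
Lemma lebesgue_tuple_isometry (Q : 'M[R]_n) (A : set T) : isometric_mx Q ->
  measurable A -> leb [set t | A (unvec (Q *m vec t))] = leb A.
Proof.
move=> iQ mA; pose B := eball (n%:R + 1).
have mB : measurable B := measurable_eball _.
have iQN : isometric_mx (- Q) := isometryN _ iQ.
have := lebesgue_tuple_mulmx (- Q) A B (isometry_unitmx _ iQN) mA mB.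
rewrite (_ : [set t | B _] = B); last first.
  by apply/seteqP; split=> t; rewrite /B /eball /= unvecK enorm_isometry.
rewrite opprK.
have B0 : (0 < leb B)%E.
  rewrite (@lt_le_trans _ _ (leb (box (fun=> `[- 1, 1]%classic))))//.
    by rewrite lebesgue_tuple_cube// mulr1 lte_fin exprn_gt0.
  apply: le_measure; rewrite ?inE//.
    by apply: measurable_box => i; exact: measurable_itv.
  exact: cube_sub_eball.
have Boo : leb B \is a fin_num.
  rewrite ge0_fin_numE//.
  apply: (@le_lt_trans _ _ (leb (box (fun=> `[- (n%:R + 1), n%:R + 1]%classic)))).
    apply: le_measure; rewrite ?inE//.
      by apply: measurable_box => i; exact: measurable_itv.
    exact: eball_sub_cube.
  by rewrite lebesgue_tuple_cube ?addr_ge0// ltry.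
move: B0; rewrite -(fineK Boo) lte_fin => B0; rewrite muleC => /esym.
move=> /(congr1 (fun x => (fine (leb B))^-1%:E * x)%E).
by rewrite !muleA -EFinM mulVf ?gt_eqF// !mul1e.
Qed.

Lemma ge0_integral_isometry (Q : 'M[R]_n) r (f : T -> \bar R) : isometric_mx Q ->
  measurable_fun setT f -> (forall t, 0 <= f t)%E ->
  (\int[leb]_(t in eball r) f (unvec (Q *m vec t)) =
   \int[leb]_(t in eball r) f t)%E.
Proof.
move=> iQ mf f0; pose phi (t : T) := unvec (Q *m vec t).
have mphi : measurable_fun setT phi := measurable_unvec_mulmx Q.
have [m mE] := ex_pushforward _ _ _ _ _ leb _ mphi.
have preim : phi @^-1` eball r = eball r.
  by apply/seteqP; split=> t; rewrite /eball /= /phi unvecK enorm_isometry.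
have push : (\int[pushforward leb phi]_(t in eball r) f t =
    \int[leb]_(t in phi @^-1` eball r) f (phi t))%E.
  apply: (ge0_integral_pushforward mphi) => //.
  - exact: measurable_eball.
  - exact: measurable_funTS.
rewrite preim in push; apply: etrans (esym push) _.
have -> : pushforward leb phi = m by apply/funext => A; rewrite mE.
apply: eq_measure_integral => A mA _; rewrite mE.
exact: lebesgue_tuple_isometry.
Qed.

(** The nonnegative change of variables is applied to the positive and negative parts separately. *)
Lemma ball_integral_isometry (Q : 'M[R]_n) r (f : 'cV[R]_n -> R) : isometric_mx Q ->
  measurable_fun setT (fun t : T => f (vec t)) ->
  ball_integral r (fun w => f (Q *m w)) = ball_integral r f.
Proof.
move=> iQ mf; rewrite /ball_integral /Rintegral; congr fine.
pose g (t : T) := (f (vec t))%:E.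
have mg : measurable_fun setT g by exact/measurable_EFinP.
rewrite [LHS]integralE [RHS]integralE; congr (_ - _)%E.
  rewrite -(ge0_integral_isometry Q r g^\+%E)//; last exact: measurable_funepos.
  by apply: eq_integral => t _; rewrite !funeposE /g /= unvecK.
rewrite -(ge0_integral_isometry Q r g^\-%E)//; last exact: measurable_funeneg.
by apply: eq_integral => t _; rewrite !funenegE /g /= unvecK.
Qed.

End isometry.

(** * Integrability of radial powers *)

Section integrability.
Context {R : realType} {n : nat}.
Local Notation RT := (measurableTypeR R).
Local Notation T := (n.-tuple RT).
Local Notation leb := (@lebesgue_measure_tuple R n).

(** Take the least k satisfying the lower bound. Minimality gives the upper bound when k > 0, and s
    < delta gives it when k = 0. *)
Lemma dyadic_shell (delta s : R) : 0 < s -> s < delta ->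
  exists k, 2^-1 ^+ k.+1 * delta < s <= 2^-1 ^+ k * delta.
Proof.
move=> s0 sd.
have : exists k, 2^-1 ^+ k.+1 * delta < s.
  have bd := archi_boundP (ltW (divr_gt0 (lt_trans s0 sd) s0)).
  exists (Num.bound (delta / s)).
  rewrite exprVn mulrC ltr_pdivrMr ?exprn_gt0// mulrC -ltr_pdivrMr//.
  apply: (lt_trans bd); rewrite -natrX ltr_nat.
  by apply: (leq_trans (ltn_expl (m:=2) _ _)) => //; rewrite leq_exp2l.
move=> /ex_minnP[k ks kmin]; exists k; rewrite ks /=.
case: k kmin {ks} => [|k] kmin; first by rewrite mul1r ltW.
by rewrite leNgt; apply/negP => /kmin; rewrite ltnn.
Qed.

(** The power is at most 1 when p >= 0 and at most (1/2)^p when p < 0; the sum covers both signs. *)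
Lemma powR_le_shell (r p : R) : 2^-1 < r <= 1 -> r `^ p <= 1 + 2^-1 `^ p.
Proof.
move=> /andP[r2 r1]; have r0 : 0 < r by lra.
have h0 : 0 < 2^-1 :> R by lra.
have [p0|p0] := leP 0 p.
  apply: (@le_trans _ _ 1); last by rewrite lerDl powR_ge0.
  have <- : 1 `^ p = 1 by rewrite powR1.
  by apply: ge0_ler_powR => //; rewrite nnegrE ltW.
apply: (@le_trans _ _ (2^-1 `^ p)); last by rewrite lerDr.
rewrite -[p]opprK powRN [leRHS]powRN lef_pV2 ?posrE ?powR_gt0//.
by apply: ge0_ler_powR; rewrite ?nnegrE ?oppr_ge0 ltW.
Qed.

Lemma nneseries_geometric_lty (c z : R) : 0 <= c -> 0 <= z -> z < 1 ->
  (\sum_(k <oo) (c * z ^+ k)%:E < +oo)%E.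
Proof.
move=> c0 z0 z1; apply: (@le_lt_trans _ _ (c / (1 - z))%:E); last exact: ltry.
have t0 k : (0 <= (c * z ^+ k)%:E)%E by rewrite lee_fin mulr_ge0 ?exprn_ge0.
apply: lime_le; first by apply: is_cvg_nneseries => k _ _; exact: t0.
apply: nearW => m; rewrite sumEFin lee_fin.
have -> : \sum_(0 <= k < m) c * z ^+ k = series (geometric c z) m by [].
rewrite geometric_seriesE ?lt_eqF// ler_pM2r ?invr_gt0 ?subr_gt0//.
by rewrite ler_piMr// gerBl exprn_ge0.
Qed.

(** The power bound is required only off the origin because the dyadic shells miss it; there the
    domination comes from f being zero. *)
Lemma integrable_enorm_powR (delta p : R) (f : T -> R) : 0 < delta ->
  - n%:R < p -> measurable_fun setT f ->
  (forall t, vec t = 0 -> f t = 0) ->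
  (forall t, vec t != 0 -> `|f t| <= enorm (vec t) `^ p) ->
  leb.-integrable (eball delta) (fun t => (f t)%:E).
Proof.
move=> d0 np mf f0 fp.
pose h : R := 2^-1; have h0 : 0 < h by rewrite /h; lra.
pose z := h `^ p; have z0 : 0 <= z by exact: powR_ge0.
(* On the k-th shell |w| = h^k delta r with 1/2 < r <= 1, hence |w|^p = z^k delta^p r^p, where r^p
   <= 1 + z by [powR_le_shell]. *)
pose C := delta `^ p * (1 + z).
have C0 : 0 <= C by rewrite mulr_ge0 ?powR_ge0// addr_ge0.
pose cube k : set T := box (fun=> `[- (h ^+ k * delta), h ^+ k * delta]%classic).
have mcube k : measurable (cube k).
  by apply: measurable_box => i; exact: measurable_itv.
pose g k (t : T) : \bar R := ((C * z ^+ k) * \1_(cube k) t)%:E.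
have mg k : measurable_fun setT (g k).
  by apply/measurable_EFinP; apply: measurable_funM.
have Cz0 k : 0 <= C * z ^+ k by apply: mulr_ge0 => //; exact: exprn_ge0.
have g0 k t : (0 <= g k t)%E.
  by rewrite lee_fin indicE mulr_ge0.
(* On the shell h^(k+1) delta < |w| <= h^k delta, |w|^p <= C z^k, and the cube
   containing the shell has volume proportional to h^(k n); since h^(p + n) < 1
   the integrals of the terms of G form a convergent geometric series. *)
pose G t := (\sum_(k <oo) g k t)%E.
have intG : leb.-integrable setT G.
  have mG : measurable_fun setT G.
    exact: ge0_emeasurable_sum.
  apply/integrableP; split => //.
  under eq_integral do rewrite gee0_abs ?nneseries_ge0//.
  rewrite integral_nneseries//.
  pose x := z * h ^+ n.
  have x1 : x < 1.
    have pn : 0 < p + n%:R by rewrite -ltrBlDr sub0r.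
    have one : 1 `^ (p + n%:R) = 1 :> R by rewrite powR1.
    rewrite /x /z -powR_mulrn ?(ltW h0)// -powRD ?(gt_eqF pn)// -[ltRHS]one.
    apply: gt0_ltr_powR; rewrite ?nnegrE ?(ltW h0)//; rewrite /h; lra.
  have x0 : 0 <= x by apply: mulr_ge0 => //; rewrite exprn_ge0// ltW.
  have c0 : 0 <= C * (2 * delta) ^+ n.
    by apply: mulr_ge0 => //; rewrite exprn_ge0// mulr_ge0// ltW.
  apply: le_lt_trans (nneseries_geometric_lty _ _ c0 x0 x1).
  apply: lee_nneseries => [k _ _|k _].
    by apply: integral_ge0 => t _; exact: g0.
  rewrite /g; under eq_integral do rewrite EFinM.
  rewrite ge0_integralZl_EFin//.
    have rk : 0 <= h ^+ k * delta.
      by apply: mulr_ge0; rewrite ?exprn_ge0 ?(ltW h0) ?(ltW d0).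
    rewrite integral_indic// setIT [X in (_ * X)%E](lebesgue_tuple_cube _ rk).
    rewrite -EFinM lee_fin le_eqVlt; apply/orP; left; apply/eqP.
    have -> : (2 * (h ^+ k * delta)) ^+ n = (h ^+ n) ^+ k * (2 * delta) ^+ n.
      by rewrite mulrCA exprMn -!exprM mulnC.
    rewrite /x (exprMn k z (h ^+ n)) -!mulrA; congr (_ * _).
    by congr (_ * _); rewrite [LHS]mulrA [LHS]mulrC.
  by apply/measurable_EFinP.
apply: (@le_integrable _ _ _ leb _ (measurable_eball delta) _ G).
- by apply/measurable_EFinP; exact: measurable_funTS.
- move=> t td.
  have G0 : (0 <= G t)%E by apply: nneseries_ge0 => k _ _; exact: g0.
  rewrite (gee0_abs G0) /=.
  have [t0|t0] := eqVneq (vec t) 0; first by rewrite f0// normr0.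
  have s0 : 0 < enorm (vec t) by rewrite lt_neqAle enorm_ge0 eq_sym enorm_eq0 t0.
  have [k /andP[k1 k2]] := dyadic_shell _ _ s0 td.
  apply: (@le_trans _ _ (g k t)); last first.
    apply: (le_trans _ (nneseries_lim_ge k.+1 _)) => //.
    by rewrite big_nat_recr//= leeDr// sume_ge0.
  rewrite /g lee_fin indicE mem_set ?mulr1.
    apply: (le_trans (fp _ t0)).
    pose s := h ^+ k * delta; have s00 : 0 < s by rewrite mulr_gt0 ?exprn_gt0.
    have -> : enorm (vec t) = s * (enorm (vec t) / s).
      by rewrite mulrC divfK// gt_eqF.
    rewrite powRM ?(ltW s00) ?divr_ge0 ?(ltW s00) ?(ltW s0)//.
    rewrite /s powRM ?exprn_ge0 ?(ltW h0) ?(ltW d0)//.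
    have -> : (h ^+ k) `^ p = z ^+ k.
      by rewrite -powR_mulrn ?(ltW h0)// powRAC powR_mulrn.
    rewrite [leRHS]mulrC -mulrA ler_wpM2l ?exprn_ge0//.
    rewrite /C ler_wpM2l ?powR_ge0//.
    apply: powR_le_shell; rewrite ltr_pdivlMr// ler_pdivrMr// mul1r.
    by rewrite k2 andbT /s mulrA -exprS.
  move=> i /=; rewrite in_itv /= -ler_norml.
  have := coord_le_enorm (vec t) i; rewrite mxE => /le_trans; apply.
  exact: k2.
- by apply: (integrableS measurableT) => //; exact: measurable_eball.
Qed.

(** Off the origin the bounding quotient is |w|^(2 - beta), whose exponent exceeds -n since beta < n
    + 2. At the origin its numerator vanishes, which forces f to vanish too. *)
Lemma integrable_eball (delta beta : R) (f : T -> R) : 0 < delta ->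
  beta < n%:R + 2 -> measurable_fun setT f ->
  (exists C, forall t,
    `|f t| <= C * (enorm (vec t) ^+ 4 / enorm (vec t) `^ (beta + 2))) ->
  leb.-integrable (eball delta) (fun t => (f t)%:E).
Proof.
move=> d0 bn mf [C fC].
have fp t : vec t != 0 -> enorm (vec t) ^+ 4 / enorm (vec t) `^ (beta + 2) =
    enorm (vec t) `^ (2 - beta).
  move=> t0; rewrite -powR_mulrn ?enorm_ge0// -powRB; last first.
    by rewrite enorm_eq0 t0 implybT.
  congr (_ `^ _); ring.
(* Dividing by |C| + 1, which is positive whatever the sign of C, normalizes the constant in the
   bound to 1. *)
pose g t : R := f t / (`|C| + 1).
have D0 : 0 < `|C| + 1 by rewrite ltr_wpDl.
have ig : leb.-integrable (eball delta) (fun t => (g t)%:E).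
  apply: (integrable_enorm_powR _ (2 - beta)) => //.
  - lra.
  - by apply: measurable_funM.
  - move=> t t0; have := fC t; rewrite t0 (_ : enorm 0 = 0); last first.
      by apply/eqP; rewrite enorm_eq0.
    rewrite expr0n /= mul0r mulr0 normr_le0 => /eqP.
    by rewrite /g => ->; rewrite mul0r.
  - move=> t t0; rewrite /g normrM normfV (gtr0_norm D0) ler_pdivrMr// mulrC.
    rewrite -fp//; apply: (le_trans (fC t)); rewrite ler_wpM2r//.
      by rewrite divr_ge0 ?exprn_ge0 ?enorm_ge0 ?powR_ge0.
    by rewrite (le_trans (ler_norm C))// lerDl.
apply: eq_integrable (integrableZl _ (`|C| + 1) ig); first exact: measurable_eball.
  by move=> t _; rewrite -EFinM /g mulrC divfK// gt_eqF.
exact: measurable_eball.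
Qed.

End integrability.

(** * Trigonometric bounds *)

Section trigonometric_bounds.
Context {R : realType}.
Implicit Types (f df : R -> R) (x : R).

(** Used as a ladder: a bound by |x|^k on the derivative becomes a bound by |x|^(k+1) on the
    function. This gives in turn the bounds on sin x, cos x - 1 and sin x - x, for x of either
    sign. *)
Lemma mean_value0 f df x : (forall y : R, is_derive y 1 f (df y)) -> f 0 = 0 ->
  exists2 c, `|c| <= `|x| & f x = df c * x.
Proof.
move=> fdf f0.
have cf a b : {within `[a, b], continuous f}.
  apply: continuous_subspaceT => y; apply: differentiable_continuous.
  by apply/derivable1_diffP; have [] := fdf y.
have [x0|x0|->] := ltgtP x 0.
- have [c] := MVT x0 (fun y _ => fdf y) (cf _ _).
  rewrite in_itv /= f0 !sub0r => /andP[xc c0] fE.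
  exists c; first by rewrite !ltr0_norm// lerN2 ltW.
  by rewrite -[f x]opprK fE mulrN opprK.
- have [c] := MVT x0 (fun y _ => fdf y) (cf _ _).
  rewrite in_itv /= f0 !subr0 => /andP[c0 cx] fE.
  by exists c => //; rewrite !gtr0_norm// ltW.
- by exists 0 => //; rewrite mulr0.
Qed.

Lemma norm_sin_le x : `|sin x| <= `|x|.
Proof.
have [c _ ->] := mean_value0 sin cos x (@is_derive_sin R) (@sin0 R).
by rewrite normrM ler_piMl// cos_max.
Qed.

Lemma norm_cosB1_le x : `|cos x - 1| <= `|x| ^+ 2.
Proof.
have dcos (y : R) : is_derive y 1 (fun z : R => cos z - 1) (- sin y).
  by rewrite -[- sin y]subr0; apply: is_deriveB.
have [|c cx ->] := mean_value0 _ _ x dcos; first by rewrite cos0 subrr.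
rewrite normrM normrN expr2 ler_wpM2r//.
exact: le_trans (norm_sin_le c) cx.
Qed.

Lemma norm_sinB_le x : `|sin x - x| <= `|x| ^+ 3.
Proof.
have dsin (y : R) : is_derive y 1 (fun z : R => sin z - z) (cos y - 1).
  by apply: is_deriveB.
have [|c cx ->] := mean_value0 _ _ x dsin; first by rewrite sin0 subrr.
rewrite normrM exprSr ler_wpM2r//.
by rewrite (le_trans (norm_cosB1_le c))// lerXn2r ?nnegrE.
Qed.

(** Here a = nu.w, b = eta.w and g is the weight. Along the rotation, nu.w becomes A = a cos x + b
    sin x and eta.w becomes B = b cos x - a sin x, with A' = B and B' = - A; the formula is the
    product rule for B g (sin A - A). *)
Lemma is_derive_rotation (a b g x : R) :
  is_derive x 1
    (fun y => (b * cos y - a * sin y) *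
      (g * (sin (a * cos y + b * sin y) - (a * cos y + b * sin y))))
    (g * ((b * cos x - a * sin x) ^+ 2 * (cos (a * cos x + b * sin x) - 1)
     - (a * cos x + b * sin x) *
       (sin (a * cos x + b * sin x) - (a * cos x + b * sin x)))).
Proof.
pose A (y : R) := a * cos y + b * sin y.
pose B (y : R) := b * cos y - a * sin y.
have dA : is_derive x 1 A (B x).
  apply: (is_derive_eq (is_deriveD (is_deriveZ a (is_derive_cos x))
    (is_deriveZ b (is_derive_sin x)))).
  by rewrite /B /= /GRing.scale /=; ring.
have dB : is_derive x 1 B (- A x).
  rewrite (_ : B = b *: (cos : R -> R) - a *: (sin : R -> R))//.
  apply: is_derive_eq.
  by rewrite /A /= /GRing.scale /=; ring.
have dsA : is_derive x 1 (sin \o A) (B x * cos (A x)).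
  apply: is_derive_eq.
  by rewrite /= mulrC.
have dAll : is_derive x 1 (B * (g *: (sin \o A - A)))
  (B x * (g * (B x * cos (A x) - B x)) + g * (sin (A x) - A x) * (- A x)).
  exact: is_derive_eq.
apply: (is_derive_eq dAll).
rewrite /A /B; ring.
Qed.

End trigonometric_bounds.

(** * Reflections and plane rotations *)

Section plane_isometries.
Context {R : realType} {n : nat}.
Implicit Types (u v w nu eta zeta : 'cV[R]_n).

Lemma mul_outer u v w : (u *m v^T) *m w = dotv v w *: u.
Proof.
rewrite -mulmxA; apply/colP => i; rewrite !mxE big_ord1 mulrC.
by congr (_ * _); rewrite mxE; apply: eq_bigr => j _; rewrite mxE.
Qed.

Definition reflection zeta : 'M[R]_n :=
  1%:M - (2 / dotv zeta zeta) *: (zeta *m zeta^T).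

Lemma reflectionE zeta w :
  reflection zeta *m w = w + (- (2 / dotv zeta zeta * dotv zeta w)) *: zeta.
Proof.
by rewrite mulmxBl mul1mx -scalemxAl mul_outer scalerA scaleNr.
Qed.

Lemma isometry_reflection zeta : zeta != 0 -> isometric_mx (reflection zeta).
Proof.
rewrite -dotv_eq0 => z0 w.
rewrite reflectionE !dotvDr !dotvDl !dotvZr !dotvZl (dotvC w zeta).
by field.
Qed.

Lemma dotv_reflection zeta w : zeta != 0 ->
  dotv zeta (reflection zeta *m w) = - dotv zeta w.
Proof.
by rewrite -dotv_eq0 => z0; rewrite reflectionE dotvDr dotvZr; field.
Qed.

Lemma dotv_reflection_orth zeta v w : dotv zeta v = 0 ->
  dotv v (reflection zeta *m w) = dotv v w.
Proof.
by move=> zv; rewrite reflectionE dotvDr dotvZr (dotvC v zeta) zv mulr0 addr0.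
Qed.

(** When eta is orthogonal to a nonzero nu and has the same norm, this turns the plane they span by
    the angle x, sending nu to cos x nu - sin x eta, and fixes the orthogonal complement. *)
Definition rotation nu eta (x : R) : 'M[R]_n :=
  1%:M + (dotv nu nu)^-1 *:
    ((cos x - 1) *: (nu *m nu^T + eta *m eta^T) +
     sin x *: (nu *m eta^T - eta *m nu^T)).

Lemma rotationE nu eta x w : rotation nu eta x *m w = w +
  ((dotv nu nu)^-1 * ((cos x - 1) * dotv nu w + sin x * dotv eta w)) *: nu +
  ((dotv nu nu)^-1 * ((cos x - 1) * dotv eta w - sin x * dotv nu w)) *: eta.
Proof.
rewrite mulmxDl mul1mx -scalemxAl mulmxDl -!scalemxAl mulmxBl mulmxDl !mul_outer.
apply/colP => i; rewrite !mxE; ring.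
Qed.

Section rotation.
Variables (nu eta : 'cV[R]_n).
Hypotheses (nu0 : nu != 0) (nu_eta : dotv nu eta = 0)
  (eq_norm : dotv eta eta = dotv nu nu).

Lemma dotv_rotation1 x w :
  dotv nu (rotation nu eta x *m w) = dotv nu w * cos x + dotv eta w * sin x.
Proof.
have := nu0; rewrite -dotv_eq0 => nn0.
by rewrite rotationE !dotvDr !dotvZr nu_eta; field.
Qed.

Lemma dotv_rotation2 x w :
  dotv eta (rotation nu eta x *m w) = dotv eta w * cos x - dotv nu w * sin x.
Proof.
have := nu0; rewrite -dotv_eq0 => nn0.
by rewrite rotationE !dotvDr !dotvZr (dotvC eta nu) nu_eta eq_norm; field.
Qed.

Lemma isometry_rotation x : isometric_mx (rotation nu eta x).
Proof.
move=> w; have := nu0; rewrite -dotv_eq0 => nn0.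
rewrite rotationE !dotvDr !dotvDl !dotvZr !dotvZl (dotvC eta nu) nu_eta eq_norm.
rewrite (dotvC w nu) (dotvC w eta).
have := cos2Dsin2 x; move: (cos x) (sin x) => c s.
move: (dotv nu w) (dotv eta w) => a b cs.
set N := dotv nu nu.
(* The change in squared norm is isolated as a multiple of cos^2 + sin^2 - 1, leaving an identity of
   rational functions. *)
transitivity (dotv w w + (a ^+ 2 + b ^+ 2) / N * (c ^+ 2 + s ^+ 2 - 1)).
  by rewrite /N; field.
by rewrite cs subrr mulr0 addr0.
Qed.

End rotation.

(** The residual w of projecting u onto v is orthogonal to v, so w.w = w.u = 0 by the hypothesis.
    This converts vanishing scalar tests into eigenvector equations. *)
Lemma dotv_collinear u v : v != 0 ->
  (forall w, dotv w v = 0 -> dotv w u = 0) ->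
  u = (dotv v u / dotv v v) *: v.
Proof.
move=> v0 h; apply/eqP; rewrite -subr_eq0 -dotv_eq0; apply/eqP.
set w := u - _.
have wv : dotv w v = 0.
  rewrite /w dotvDl -scaleNr dotvZl (dotvC u) mulNr divfK ?subrr//.
  by rewrite dotv_eq0.
by rewrite {2}/w dotvDr -scaleNr dotvZr wv mulr0 addr0 h.
Qed.

End plane_isometries.

(** * Linearity of the ball integral *)

Section dominated.
Context {R : realType} {n : nat}.
Variables (delta beta : R).
Hypotheses (delta_gt0 : 0 < delta) (beta_lt : beta < n%:R + 2).
Local Notation RT := (measurableTypeR R).
Local Notation T := (n.-tuple RT).
Local Notation leb := (@lebesgue_measure_tuple R n).
Implicit Types (v w nu eta zeta : 'cV[R]_n) (f g : 'cV[R]_n -> R).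

Definition weight w : R := (enorm w `^ (beta + 2))^-1.

Definition measurable_vfun f := measurable_fun setT (fun t : T => f (vec t)).

(* The bound is O(|w|^(2 - beta)), written so that it also forces f 0 = 0. *)
Definition dominated f := measurable_vfun f /\
  exists C, forall w, `|f w| <= C * (enorm w ^+ 4 * weight w).

Lemma weight_ge0 w : 0 <= weight w.
Proof. by rewrite invr_ge0 powR_ge0. Qed.

Lemma measurable_weight : measurable_vfun weight.
Proof.
rewrite /measurable_vfun; under eq_fun do rewrite /weight -powRN.
apply: (measurableT_comp (f := fun x : R => x `^ (- (beta + 2)))).
  exact: measurable_powR.
exact: measurable_enorm.
Qed.

Lemma dominatedM (h : 'cV[R]_n -> R) : measurable_vfun h ->
  (exists C, forall w, `|h w| <= C * enorm w ^+ 4) ->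
  dominated (fun w => weight w * h w).
Proof.
move=> mh [C hC]; split; first exact: measurable_funM measurable_weight mh.
exists C => w; rewrite normrM (ger0_norm (weight_ge0 w)) mulrC mulrA.
by rewrite ler_wpM2r// weight_ge0.
Qed.

Lemma dominatedD f g : dominated f -> dominated g ->
  dominated (fun w => f w + g w).
Proof.
move=> [mf [C fC]] [mg [D gD]]; split; first exact: measurable_funD mf mg.
exists (C + D) => w; rewrite mulrDl.
by rewrite (le_trans (ler_normD _ _))// lerD.
Qed.

Lemma dominatedZ (k : R) f : dominated f -> dominated (fun w => k * f w).
Proof.
move=> [mf [C fC]]; split; first exact: measurable_funM.
by exists (`|k| * C) => w; rewrite normrM -mulrA ler_wpM2l.
Qed.

Lemma dominated_sum I (s : seq I) (f : I -> 'cV[R]_n -> R) :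
  (forall i, dominated (f i)) -> dominated (fun w => \sum_(i <- s) f i w).
Proof.
move=> df; elim: s => [|i s IH].
  under [X in dominated X]eq_fun do rewrite big_nil.
  split; first exact: measurable_cst.
  by exists 0 => w; rewrite normr0 mul0r.
under [X in dominated X]eq_fun do rewrite big_cons.
exact: dominatedD.
Qed.

Lemma dominated_isometric f Q : isometric_mx Q -> dominated f ->
  dominated (fun w => f (Q *m w)).
Proof.
move=> iQ [mf [C fC]]; split; last first.
  by exists C => w; have := fC (Q *m w); rewrite /weight enorm_isometry.
rewrite /measurable_vfun; under eq_fun do rewrite -[_ *m _]unvecK.
exact: measurableT_comp mf (measurable_unvec_mulmx Q).
Qed.

Lemma integrable_dominated f : dominated f ->
  leb.-integrable (eball delta) (fun t => (f (vec t))%:E).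
Proof.
move=> [mf [C fC]]; apply: (integrable_eball delta beta) => //.
by exists C => t; exact: fC.
Qed.

Lemma ball_integralZ (k : R) f : dominated f ->
  ball_integral delta (fun w => k * f w) = k * ball_integral delta f.
Proof.
move=> df; apply: RintegralZl; first exact: measurable_eball.
exact: integrable_dominated.
Qed.

Lemma ball_integralD f g : dominated f -> dominated g ->
  ball_integral delta (fun w => f w + g w) =
  ball_integral delta f + ball_integral delta g.
Proof.
move=> df dg; apply: RintegralD; first exact: measurable_eball.
  exact: integrable_dominated.
exact: integrable_dominated.
Qed.

Lemma ball_integral_sum I (s : seq I) (f : I -> 'cV[R]_n -> R) :
  (forall i, dominated (f i)) ->
  ball_integral delta (fun w => \sum_(i <- s) f i w) =
  \sum_(i <- s) ball_integral delta (f i).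
Proof.
move=> df; elim: s => [|i s IH].
  rewrite big_nil; under [X in ball_integral _ X]eq_fun do rewrite big_nil.
  by rewrite /ball_integral /Rintegral integral0.
rewrite big_cons -IH -ball_integralD//; last exact: dominated_sum.
by congr ball_integral; apply/funext => w; rewrite big_cons.
Qed.

(** Invariance under Q shows that the integral equals its own opposite. *)
Lemma ball_integral_odd f Q : isometric_mx Q -> dominated f ->
  (forall w, f (Q *m w) = - f w) -> ball_integral delta f = 0.
Proof.
move=> iQ df fQ; have := ball_integral_isometry Q delta f iQ df.1.
under [X in ball_integral _ X]eq_fun do rewrite fQ -mulN1r.
rewrite ball_integralZ// mulN1r => /eqP; rewrite eq_sym -subr_eq0 opprK.
by rewrite -mulr2n mulrn_eq0 => /eqP.
Qed.

Lemma dotv_ball_integral zeta (F : 'cV[R]_n -> 'cV[R]_n) :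
  (forall i, dominated (fun w => F w i 0)) ->
  dotv zeta (ball_integral_mx delta F) =
  ball_integral delta (fun w => dotv zeta (F w)).
Proof.
move=> dF; rewrite ball_integral_sum => [|i]; last exact: dominatedZ.
by apply: eq_bigr => i _; rewrite mxE ball_integralZ.
Qed.

Lemma dotv_ball_integral_mul zeta eta (F : 'cV[R]_n -> 'M[R]_n) :
  (forall i j, dominated (fun w => F w i j)) ->
  dotv zeta (ball_integral_mx delta F *m eta) =
  ball_integral delta (fun w => dotv zeta (F w *m eta)).
Proof.
move=> dF.
have dFe i : dominated (fun w => (F w *m eta) i 0).
  rewrite (_ : (fun _ => _) = (fun w => \sum_j eta j 0 * F w i j)).
    by apply: dominated_sum => j; exact: dominatedZ.
  by apply/funext => w; rewrite mxE; apply: eq_bigr => j _; rewrite mulrC.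
rewrite -dotv_ball_integral//; congr dotv; apply/colP => i; rewrite !mxE.
rewrite (_ : (fun _ => _) = (fun w => \sum_j eta j 0 * F w i j)).
  rewrite ball_integral_sum => [|j]; last exact: dominatedZ.
  by apply: eq_bigr => j _; rewrite mxE ball_integralZ// mulrC.
by apply/funext => w; rewrite mxE; apply: eq_bigr => j _; rewrite mulrC.
Qed.

End dominated.

(** * The three integrands *)

Section integrands.
Context {R : realType} {n : nat}.
Variables (delta beta : R) (nu : 'cV[R]_n).
Hypotheses (delta_gt0 : 0 < delta) (beta_lt : beta < n%:R + 2).
Hypothesis nu_neq0 : nu != 0.
Local Notation RT := (measurableTypeR R).
Local Notation T := (n.-tuple RT).
Local Notation leb := (@lebesgue_measure_tuple R n).
Local Notation weight := (weight beta).
Local Notation dominated := (dominated beta).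
Implicit Types (v w eta zeta : 'cV[R]_n).

(** The integrand of the bilinear form of [M_b] at (zeta, eta), without the constant in front. *)
Definition stretch zeta eta w : R :=
  weight w * ((cos (dotv nu w) - 1) * (dotv zeta w * dotv eta w)).

(* The factor |w|^2 turns the weight |w|^(-beta-2) into the |w|^(-beta) of M_s. *)
Definition flux zeta w : R :=
  weight w * (enorm w ^+ 2 * (sin (dotv nu w) * dotv zeta w)).

(** For zeta = nu this is the integrand of [lambda2] up to the factor |nu|^2; for zeta = eta it is
    the function that is composed with rotations. *)
Definition shear zeta w : R :=
  weight w * (dotv zeta w * (sin (dotv nu w) - dotv nu w)).

Lemma normM_le (x y a b : R) : `|x| <= a -> `|y| <= b -> `|x * y| <= a * b.
Proof. by move=> xa yb; rewrite normrM ler_pM. Qed.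

Lemma measurable_cos_dotv : measurable_vfun (fun w => cos (dotv nu w)).
Proof.
apply: (measurableT_comp (f := @cos R)); last exact: measurable_dotv.
by apply: continuous_measurable_fun; exact: continuous_cos.
Qed.

Lemma measurable_sin_dotv : measurable_vfun (fun w => sin (dotv nu w)).
Proof.
apply: (measurableT_comp (f := @sin R)); last exact: measurable_dotv.
by apply: continuous_measurable_fun; exact: continuous_sin.
Qed.

(** The four powers of |w| come from cos - 1 (two) and the two dot products (one each). For [shear]
    they split as three from sin x - x plus one; for [flux], as the explicit |w|^2 plus one each
    from the sine and the dot product. *)
Lemma dominated_stretch zeta eta : dominated (stretch zeta eta).
Proof.
apply: dominatedM.
  apply: measurable_funM.
    by apply: measurable_funB => //; exact: measurable_cos_dotv.
  by apply: measurable_funM; exact: measurable_dotv.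
exists (enorm nu ^+ 2 * (enorm zeta * enorm eta)) => w.
have -> : enorm nu ^+ 2 * (enorm zeta * enorm eta) * enorm w ^+ 4 =
  (enorm nu * enorm w) ^+ 2 * ((enorm zeta * enorm w) * (enorm eta * enorm w)).
  by ring.
apply: normM_le; last by apply: normM_le; exact: dotv_le.
apply: (le_trans (norm_cosB1_le _)).
by rewrite lerXn2r ?nnegrE ?mulr_ge0 ?enorm_ge0// dotv_le.
Qed.

Lemma dominated_shear zeta : dominated (shear zeta).
Proof.
apply: dominatedM.
  apply: measurable_funM; first exact: measurable_dotv.
  by apply: measurable_funB; [exact: measurable_sin_dotv|exact: measurable_dotv].
exists (enorm zeta * enorm nu ^+ 3) => w.
have -> : enorm zeta * enorm nu ^+ 3 * enorm w ^+ 4 =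
  (enorm zeta * enorm w) * (enorm nu * enorm w) ^+ 3 by ring.
apply: normM_le; first exact: dotv_le.
apply: (le_trans (norm_sinB_le _)).
by rewrite lerXn2r ?nnegrE ?mulr_ge0 ?enorm_ge0// dotv_le.
Qed.

Lemma dominated_flux zeta : dominated (flux zeta).
Proof.
apply: dominatedM.
  apply: measurable_funM; first exact: measurable_funX measurable_enorm.
  by apply: measurable_funM; [exact: measurable_sin_dotv|exact: measurable_dotv].
exists (enorm nu * enorm zeta) => w.
have -> : enorm nu * enorm zeta * enorm w ^+ 4 =
  enorm w ^+ 2 * ((enorm nu * enorm w) * (enorm zeta * enorm w)) by ring.
apply: normM_le; first by rewrite ger0_norm// exprn_ge0 ?enorm_ge0.
apply: normM_le; last exact: dotv_le.
exact: le_trans (norm_sin_le _) (dotv_le _ _).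
Qed.

Lemma weight_isometric Q w : isometric_mx Q -> weight (Q *m w) = weight w.
Proof. by move=> iQ; rewrite /weight enorm_isometry. Qed.

Lemma ball_integral_stretch_orth zeta eta : zeta != 0 -> dotv zeta eta = 0 ->
  dotv zeta nu = 0 -> ball_integral delta (stretch zeta eta) = 0.
Proof.
move=> z0 ze zn; have iH := isometry_reflection _ z0.
apply: (ball_integral_odd _ beta _ _ _ _ iH) => //.
  exact: dominated_stretch.
move=> w; rewrite /stretch weight_isometric// dotv_reflection//.
by rewrite !dotv_reflection_orth//; ring.
Qed.

Lemma ball_integral_flux_orth zeta : zeta != 0 -> dotv zeta nu = 0 ->
  ball_integral delta (flux zeta) = 0.
Proof.
move=> z0 zn; have iH := isometry_reflection _ z0.
apply: (ball_integral_odd _ beta _ _ _ _ iH) => //.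
  exact: dominated_flux.
move=> w; rewrite /flux weight_isometric// dotv_reflection//.
by rewrite !dotv_reflection_orth// enorm_isometry//; ring.
Qed.

Lemma ball_integral_stretch_shear eta : dotv nu eta = 0 ->
  dotv eta eta = dotv nu nu ->
  ball_integral delta (stretch eta eta) = ball_integral delta (shear nu).
Proof.
move=> ne en; pose Q x := rotation nu eta x.
have iQ x : isometric_mx (Q x) by exact: isometry_rotation.
pose f x (t : T) := shear eta (Q x *m vec t).
pose df x w := stretch eta eta (Q x *m w) - shear nu (Q x *m w).
have fdf (x : R) t : is_derive x 1 (f ^~ t) (df x (vec t)).
  have := is_derive_rotation (dotv nu (vec t)) (dotv eta (vec t)) (weight (vec t)) x.
  rewrite (_ : (fun y => _ * _) = f ^~ t); last first.
    apply/funext => y; rewrite /f /shear weight_isometric//.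
    by rewrite dotv_rotation1// dotv_rotation2//; ring.
  move=> /is_derive_eq; apply; rewrite /df /stretch /shear !weight_isometric//.
  by rewrite dotv_rotation1// dotv_rotation2//; ring.
have ddf : dominated (fun w => stretch eta eta w - shear nu w).
  under [X in dominated X]eq_fun do rewrite -mulN1r.
  by apply: dominatedD; [exact: dominated_stretch|
    apply: dominatedZ; exact: dominated_shear].
have [mdf [C dfC]] := ddf.
(* A bound for the x-derivative that is uniform in x, since rotations preserve |w| and hence the
   weight. *)
pose G (t : T) : R := `|C| * (enorm (vec t) ^+ 4 * weight (vec t)).
have k0 w : 0 <= enorm w ^+ 4 * weight w.
  by rewrite mulr_ge0 ?exprn_ge0 ?enorm_ge0 ?weight_ge0.
have dG : dominated (fun w => `|C| * (enorm w ^+ 4 * weight w)).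
  apply: dominatedZ; split; last by exists 1 => w; rewrite mul1r ger0_norm.
  apply: measurable_funM; last exact: measurable_weight.
  exact: measurable_funX measurable_enorm.
have d1f x t : partial1of2 f x t = df x (vec t).
  by rewrite /partial1of2 derive1E; apply: derive_val.
have int_f x : \int[leb]_(t in eball delta) f x t = ball_integral delta (shear eta).
  by apply: (ball_integral_isometry (Q x) _ (shear eta)) => //;
    case: (dominated_shear eta).
have I0 : [set` `](-1), 1[%R] (0 : R) by rewrite /= in_itv /= ltrN10 ltr01.
have int_fx x : [set` `](-1), 1[%R] x -> leb.-integrable (eball delta) (EFin \o f x).
  move=> _.
  apply: (integrable_dominated _ beta _ _ (fun w => shear eta (Q x *m w))) => //.
  by apply: dominated_isometric => //; exact: dominated_shear.
have derf x t : [set` `](-1), 1[%R] x -> eball delta t -> derivable (f ^~ t) x 1.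
  by move=> _ _; case: (fdf x t).
have G0 t : 0 <= G t by rewrite mulr_ge0.
have intG : leb.-integrable (eball delta) (EFin \o G).
  exact: integrable_dominated dG.
have Gub x t : [set` `](-1), 1[%R] x -> eball delta t -> `|partial1of2 f x t| <= G t.
  move=> _ _; rewrite d1f /df /G.
  apply: (le_trans (dfC (Q x *m vec t))).
  by rewrite weight_isometric// enorm_isometry// ler_wpM2r// ler_norm.
have := cvg_differentiation_under_integral (measurable_eball delta) I0 int_fx derf
  G0 intG Gub.
(* The integral of f x does not depend on x, so every difference quotient is zero; its limit, the
   integral of the derivative at 0, is therefore zero. *)
under eq_fun do rewrite !int_f subrr scaler0.
move=> /(cvg_unique _ (cvg_cst _)) => /(_ (@norm_hausdorff _ R)) => lim0.
have Q0 w : Q 0 *m w = w.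
  rewrite /Q rotationE cos0 sin0 subrr !mul0r addr0 subr0 mulr0.
  by rewrite !scale0r !addr0.
have : ball_integral delta (fun w => stretch eta eta w + -1 * shear nu w) = 0.
  rewrite [RHS]lim0; apply: eq_Rintegral => t _.
  by rewrite d1f /df Q0 mulN1r.
rewrite (ball_integralD _ beta)//; last 2 first.
- exact: dominated_stretch.
- by apply: dominatedZ; exact: dominated_shear.
rewrite (ball_integralZ _ beta)//; last exact: dominated_shear.
by rewrite mulN1r => /eqP; rewrite subr_eq0 => /eqP.
Qed.

End integrands.

(** * Eigenvectors of the multiplier *)

Section multiplier.
Context {R : realType} {n : nat}.
Variables (delta beta mu lambda : R) (nu : 'cV[R]_n).
Hypotheses (delta_gt0 : 0 < delta) (beta_lt : beta < n%:R + 2).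
Hypothesis nu_neq0 : nu != 0.
Implicit Types (v w eta zeta : 'cV[R]_n).
Local Notation K := ((n%:R + 2) * mu * c_coef (n := n) delta beta).
Local Notation stretch := (stretch beta nu).
Local Notation flux := (flux beta nu).
Local Notation shear := (shear beta nu).

Lemma tensor_mul u v w : tensor u v *m w = dotv v w *: (u : 'cV[R]_n).
Proof.
apply/colP => i; rewrite !mxE /dotv mulr_suml; apply: eq_bigr => j _.
by rewrite mxE -mulrA mulrC.
Qed.

(** At the origin the left side is zero, but for beta = 0 the right side is y, because 0 to the
    power 0 is 1; hence the condition on y. *)
Lemma sqr_enorm_weight w (y : R) : (w = 0 -> y = 0) ->
  weight beta w * (enorm w ^+ 2 * y) = (enorm w `^ beta)^-1 * y.
Proof.
have [->|w0] := eqVneq w 0; first by move=> ->//; rewrite !mulr0.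
move=> _; rewrite /weight powRD ?enorm_eq0 ?(negPf w0) ?implybT//.
rewrite powR_mulrn ?enorm_ge0//; field.
by rewrite enorm_eq0 w0 powR_eq0 enorm_eq0 (negPf w0).
Qed.

Lemma dotv_M_b zeta eta : dotv zeta (M_b delta beta mu nu *m eta) =
  K * ball_integral delta (stretch zeta eta).
Proof.
rewrite -scalemxAl dotvZr (dotv_ball_integral_mul _ beta)//; last first.
  move=> i j; rewrite (_ : (fun _ => _) =
    stretch (delta_mx i 0) (delta_mx j 0)); first exact: dominated_stretch.
  apply/funext => w; rewrite !mxE /stretch /weight.
  by rewrite !dotv_delta mulrCA.
congr (_ * ball_integral _ _); apply/funext => w.
rewrite -!scalemxAl tensor_mul !dotvZr /stretch /weight (dotvC w) ; ring.
Qed.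

Definition flux_vec : 'cV[R]_n := ball_integral_mx delta (fun w =>
  sin (dotv nu w) *: ((enorm w `^ beta)^-1 *: w)).

Lemma dotv_flux_vec zeta : dotv zeta flux_vec = ball_integral delta (flux zeta).
Proof.
have fluxE eta w :
    flux eta w = dotv eta (sin (dotv nu w) *: ((enorm w `^ beta)^-1 *: w)).
  rewrite /flux sqr_enorm_weight => [|->]; last by rewrite !dotv0 mulr0.
  by rewrite !dotvZr; ring.
rewrite (dotv_ball_integral _ beta)//.
  by congr ball_integral; apply/funext => w; rewrite fluxE.
move=> i; rewrite (_ : (fun _ => _) = flux (delta_mx i 0)).
  exact: dominated_flux.
by apply/funext => w; rewrite fluxE dotv_delta.
Qed.

(** By the reflection along zeta, the flux vector is orthogonal to every zeta orthogonal to nu, so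
    it is parallel to nu. *)
Lemma flux_vecE :
  flux_vec = (ball_integral delta (flux nu) / dotv nu nu) *: nu.
Proof.
rewrite -dotv_flux_vec; apply: dotv_collinear => // zeta zn.
have [->|z0] := eqVneq zeta 0; first by rewrite dotvC dotv0.
by rewrite dotv_flux_vec ball_integral_flux_orth.
Qed.

(** The eigenvalue is the Rayleigh quotient of [M_b] at eta, obtained from [dotv_collinear]. *)
Lemma M_b_eigen eta : eta != 0 -> (forall zeta, dotv zeta eta = 0 ->
    ball_integral delta (stretch zeta eta) = 0) ->
  M_b delta beta mu nu *m eta =
  (K * (ball_integral delta (stretch eta eta) / dotv eta eta)) *: eta.
Proof.
move=> e0 h; rewrite mulrA -dotv_M_b; apply: dotv_collinear => // zeta ze.
by rewrite dotv_M_b h ?mulr0.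
Qed.

Lemma M_s_mul eta : M_s delta beta mu lambda nu *m eta =
  (- (lambda - mu) * (c_coef (n := n) delta beta ^+ 2 / 4) *
   dotv flux_vec eta) *: flux_vec.
Proof. by rewrite -scalemxAl tensor_mul scalerA. Qed.

Lemma multiplier_parallel : multiplier delta beta mu lambda nu *m nu =
  lambda1 delta beta mu lambda nu *: nu.
Proof.
have N0 : dotv nu nu != 0 by rewrite dotv_eq0.
have e0 : enorm nu != 0 by rewrite enorm_eq0.
rewrite mulmxDl M_b_eigen//; last first.
  move=> zeta zn; have [->|z0] := eqVneq zeta 0.
    (* For zeta = 0 there is no reflection to use; the integrand is identically zero and is written
       as a zero multiple. *)
    rewrite (_ : stretch _ _ = fun w => 0 * stretch 0 nu w).
      rewrite (ball_integralZ _ beta) ?mul0r//; exact: dominated_stretch.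
    by apply/funext => w; rewrite /stretch (dotvC 0) dotv0; ring.
  exact: ball_integral_stretch_orth.
rewrite M_s_mul dotvC dotv_flux_vec flux_vecE scalerA -scalerDl.
congr (_ *: _); rewrite /lambda1; congr (_ + _).
  congr (_ * _); rewrite mulrC -(ball_integralZ _ beta)//; last first.
    exact: dominated_stretch.
  congr ball_integral; apply/funext => w.
  by rewrite /stretch /weight sqr_enorm invfM; ring.
have -> : ball_integral delta (fun w : 'cV[R]_n =>
    dotv nu w / (enorm nu * enorm w `^ beta) * sin (dotv nu w)) =
    (enorm nu)^-1 * ball_integral delta (flux nu).
  rewrite -(ball_integralZ _ beta)//; last exact: dominated_flux.
  congr ball_integral; apply/funext => w.
  rewrite /flux sqr_enorm_weight => [|->]; last by rewrite dotv0 mulr0.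
  by rewrite invfM; ring.
(* With I the integral of [flux nu], the contribution of [M_s] is (c^2 / 4) I (I / |nu|^2), the
   square of (c / 2) (I / |nu|), times - (lambda - mu). *)
by rewrite -sqr_enorm; field.
Qed.

Lemma multiplier_orth eta : dotv eta nu = 0 ->
  multiplier delta beta mu lambda nu *m eta = lambda2 delta beta mu nu *: eta.
Proof.
have N0 : dotv nu nu != 0 by rewrite dotv_eq0.
have e0 : enorm nu != 0 by rewrite enorm_eq0.
(* Both sides are linear in eta, so a nonzero eta can be rescaled to the norm of nu, as the rotation
   argument requires. *)
wlog en : eta / dotv eta eta = dotv nu nu => [wlg|] eta_nu.
  have [->|eta0] := eqVneq eta 0; first by rewrite mulmx0 scaler0.
  have ee0 : enorm eta != 0 by rewrite enorm_eq0.
  pose k := enorm nu / enorm eta.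
  have k0 : k != 0 by rewrite mulf_neq0 ?invr_neq0.
  apply: (scalerI k0); rewrite scalemxAr scalerA mulrC -[RHS]scalerA wlg//.
    by rewrite dotvZr dotvZl -!sqr_enorm /k; field.
  by rewrite dotvZl eta_nu mulr0.
have eta0 : eta != 0 by rewrite -dotv_eq0 en.
rewrite mulmxDl M_b_eigen//; last first.
  (* The test vector zeta may have a component along nu, so the roles are exchanged by symmetry and
     the reflection is taken along eta, which is orthogonal to both zeta and nu. *)
  move=> zeta ze; rewrite (_ : stretch zeta eta = stretch eta zeta); last first.
    by apply/funext => w; rewrite /stretch; ring.
  by apply: ball_integral_stretch_orth; rewrite // dotvC.
(* The flux vector is parallel to nu, so [M_s] annihilates eta. *)
rewrite M_s_mul flux_vecE dotvZl (dotvC nu) eta_nu !mulr0 scale0r addr0.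
congr (_ *: _); rewrite /lambda2; congr (_ * _).
rewrite en ball_integral_stretch_shear//; last by rewrite dotvC.
rewrite mulrC -(ball_integralZ _ beta)//; last exact: dominated_shear.
congr ball_integral; apply/funext => w.
by rewrite /shear /weight sqr_enorm invfM; ring.
Qed.

End multiplier.

Theorem theorem2 (R : realType) (n : nat) (delta beta mu lambda : R)
    (nu : 'cV[R]_n)
    (n_ge1 : (1 <= n)%N) (delta_gt0 : 0 < delta) (beta_lt : beta < n%:R + 2)
    (nu_neq0 : nu != 0) :
  multiplier delta beta mu lambda nu *m nu
    = lambda1 delta beta mu lambda nu *: nu /\
  (forall eta : 'cV[R]_n, dotv eta nu = 0 ->
    multiplier delta beta mu lambda nu *m eta
      = lambda2 delta beta mu nu *: eta).
Proof.
split; first exact: multiplier_parallel.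
by move=> eta eta_nu; exact: multiplier_orth.
Qed.
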